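(* Let $E\subseteq M_2(\mathbb{C})$ be a (complex) linear subspace and let \[ \mathbb{F}_{\mu_E}=\{(a_{11},a_{22},\det(A),a_{12}+a_{21}) : A=(a_{ij})_{i,j=1}^2\in M_2(\mathbb{C}),\ \mu_E(A)<1\}. \] Then the following are equivalent: \begin{enumerate} \item $\mathbb{F}=\mathbb{F}_{\mu_E}$; \item $\mu_E(A)=\|A\|$ for all $A\in M_2(\mathbb{C})$; \item for every pair of unit vectors $u,v\in\mathbb{C}^2$, there exists $A\in E$ with $\|A\|=1$ such that $Au=v$. \end{enumerate}
   Context: $M_2(\mathbb{C})$ is the space of $2\times 2$ complex matrices and $\|A\|$ is the operator norm of $A$ (with respect to the Euclidean norm on $\mathbb{C}^2$). The domain $\mathbb{F}$ is \[ \mathbb{F}=\{(a_{11},a_{22},\det(A),a_{12}+a_{21})\in\mathbb{C}^4 : A=(a_{ij})_{i,j=1}^2\in M_2(\mathbb{C}),\ \|A\|<1\}. \] For a linear subspace $E\subseteq M_2(\mathbb{C})$, the structured singular value of $A\in M_2(\mathbb{C})$ relative to $E$ is \[ \mu_E(A)=\left(\inf\{\|X\| : X\in E,\ \det(I-AX)=0\}\right)^{-1}, \] with $\mu_E(A)=0$ if there is no $X\in E$ with $\det(I-AX)=0$. *)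

(* Defs.v *)
From HB Require Import structures.
From mathcomp Require Import all_boot all_order all_algebra.
From mathcomp Require Import all_classical reals.
From mathcomp Require Export complex.

Set Implicit Arguments.
Unset Strict Implicit.
Unset Printing Implicit Defensive.

Import Order.TTheory GRing.Theory Num.Theory.
Local Open Scope classical_set_scope.
Local Open Scope ring_scope.

Section Defs.
Variable R : realType.
Local Notation C := R[i].

(* The Euclidean norm is not a library instance: where MathComp-Analysis puts a
   norm on matrices and vectors, it is the entrywise maximum.  [normc] is the
   modulus with values in [R] rather than in [C]. *)
Definition enorm n (x : 'cV[C]_n) : R :=
  Num.sqrt (\sum_(i < n) ComplexField.Normc.normc (x i 0) ^+ 2).

Definition opnorm n (A : 'M[C]_n) : R :=
  sup [set enorm (A *m x) | x in [set x : 'cV[C]_n | enorm x <= 1]].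

Definition singularizing (E : {vspace 'M[C]_2}) (A : 'M[C]_2) :
    set 'M[C]_2 :=
  [set X | X \in E /\ \det (1%:M - A *m X) = 0].

(* The infimum is taken in [R]; when the set is nonempty it is positive, since
   [\det (1%:M - A *m X) = 0] forces [1 <= opnorm A * opnorm X]. *)
Definition mu (E : {vspace 'M[C]_2}) (A : 'M[C]_2) : R :=
  if `[< singularizing E A !=set0 >]
  then (inf [set opnorm X | X in singularizing E A])^-1
  else 0.

Definition coordinates (A : 'M[C]_2) : C * C * C * C :=
  (A 0 0, A 1 1, \det A, A 0 1 + A 1 0).

Definition domainF : set (C * C * C * C) :=
  [set coordinates A | A in [set A | opnorm A < 1]].

Definition domainF_mu (E : {vspace 'M[C]_2}) : set (C * C * C * C) :=
  [set coordinates A | A in [set A | mu E A < 1]].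

End Defs.

Arguments domainF : clear implicits.

(* Main.v *)
Require Import Defs.
From mathcomp Require Import all_boot all_order all_algebra.
From mathcomp Require Import all_classical reals.
From mathcomp Require Import topology normedtype sequences.
From mathcomp Require Import ring lra.

(* The coordinates determine A up to transposition, and ||A^T|| = ||A||.  Since
   mu_E <= ||.|| and mu_E is homogeneous, F = F_mu forces mu_E = ||.||: if
   mu_E(A) < ||A||, then A / ||A|| has norm 1 although its coordinates lie in
   F_mu.  If mu_E = ||.||, apply this to the rank one matrix A = u v^*: here
   det(1 - A X) = 0 means <v, X u> = 1, so the distance from 0 to
   {X in E | <v, X u> = 1} is 1; by compactness it is attained, and
   ||X|| <= 1 together with <v, X u> = 1 forces X u = v.  Conversely, given x
   with A x <> 0, a norm one B in E carrying the direction of A x to that of x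
   makes A B (|x| / |A x|) fix A x, whence |A x| <= mu_E(A) |x|. *)

Import Order.TTheory GRing.Theory Num.Theory.
Import numFieldNormedType.Exports.
Import ComplexField.Normc.

Local Open Scope classical_set_scope.
Local Open Scope complex_scope.
Local Open Scope ring_scope.

(** * Complex modulus, Euclidean norm and Hermitian inner product *)

Section EuclideanNorm.
Context {R : realType}.
Local Notation C := R[i].
Implicit Types (z : C) (t : R).

Lemma normc_ge0 z : 0 <= normc z.
Proof. by case: z => a b; rewrite /normc sqrtr_ge0. Qed.

Lemma sqr_normcE z : normc z ^+ 2 = complex.Re z ^+ 2 + complex.Im z ^+ 2.
Proof. by case: z => a b; rewrite /normc sqr_sqrtr // addr_ge0 ?sqr_ge0. Qed.

Lemma normc_real t : 0 <= t -> normc t%:C = t.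
Proof. by move=> t0; rewrite /normc /= expr0n addr0 sqrtr_sqr ger0_norm. Qed.

Lemma Re_le_normc z : `|complex.Re z| <= normc z.
Proof.
by rewrite -(ler_pXn2r (n := 2)) ?nnegrE ?normc_ge0 // real_normK ?num_real //
  sqr_normcE lerDl sqr_ge0.
Qed.

Lemma Im_le_normc z : `|complex.Im z| <= normc z.
Proof.
by rewrite -(ler_pXn2r (n := 2)) ?nnegrE ?normc_ge0 // real_normK ?num_real //
  sqr_normcE lerDr sqr_ge0.
Qed.

Lemma ler_normc_sum I (s : seq I) (F : I -> C) :
  normc (\sum_(i <- s) F i) <= \sum_(i <- s) normc (F i).
Proof.
elim/big_ind2: _ => [|x a y b xa yb|//]; first by rewrite normc0.
exact: le_trans (le_normcD _ _) (lerD xa yb).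
Qed.

(** The conjugate transpose; for columns, [(adj y *m x) 0 0] is the inner product of [x] and [y],
    linear in [x]. *)
Definition adj {m p} (M : 'M[C]_(m, p)) : 'M[C]_(p, m) := (map_mx (@conjc R) M)^T.

Section Vectors.
Context {n : nat}.
Implicit Types x y : 'cV[C]_n.

Lemma enorm_ge0 x : 0 <= enorm x.
Proof. exact: sqrtr_ge0. Qed.

Lemma sqr_enormE x : enorm x ^+ 2 = \sum_(i < n) normc (x i 0) ^+ 2.
Proof. by rewrite sqr_sqrtr // sumr_ge0 // => i _; rewrite sqr_ge0. Qed.

Lemma enorm0 : enorm (0 : 'cV[C]_n) = 0.
Proof.
rewrite /enorm big1 ?sqrtr0 // => i _.
by rewrite mxE normc0 expr0n.
Qed.

Lemma normc_le_enorm x i : normc (x i 0) <= enorm x.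
Proof.
rewrite -(ler_pXn2r (n := 2)) ?nnegrE ?normc_ge0 ?enorm_ge0 // sqr_enormE.
by rewrite (bigD1 i) //= lerDl sumr_ge0 // => j _; rewrite sqr_ge0.
Qed.

Lemma enorm_eq0 x : (enorm x == 0) = (x == 0).
Proof.
apply/eqP/eqP => [x0|->]; last exact: enorm0.
apply/matrixP => i j; rewrite ord1 mxE; apply: eq0_normc.
by apply/eqP; rewrite eq_le normc_ge0 andbT -x0 normc_le_enorm.
Qed.

Lemma enorm_gt0 x : (0 < enorm x) = (x != 0).
Proof. by rewrite lt_neqAle enorm_ge0 andbT eq_sym enorm_eq0. Qed.

Lemma enormZ (c : C) x : enorm (c *: x) = normc c * enorm x.
Proof.
apply/eqP; rewrite -(eqrXn2 (n := 2)) ?mulr_ge0 ?enorm_ge0 ?normc_ge0 //.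
rewrite exprMn !sqr_enormE mulr_sumr; apply/eqP/eq_bigr => i _.
by rewrite mxE normcM exprMn.
Qed.

Lemma adj_mul_self x : (adj x *m x) 0 0 = (enorm x ^+ 2)%:C.
Proof.
rewrite sqr_enormE rmorph_sum mxE; apply: eq_bigr => i _.
rewrite !mxE mulrC sqr_normcE; case: (x i 0) => a b.
by apply/eqP; rewrite eq_complex /=; apply/andP; split; apply/eqP; ring.
Qed.

(** Serves the equality case of Cauchy-Schwarz: it turns a known inner product into a bound on the
    distance. *)
Lemma sqr_enormB x y :
  enorm (x - y) ^+ 2 =
  enorm x ^+ 2 + enorm y ^+ 2 - 2 * complex.Re ((adj y *m x) 0 0).
Proof.
rewrite !sqr_enormE mxE raddf_sum mulr_sumr -big_split -sumrB /=.
apply: eq_bigr => i _; rewrite !mxE !sqr_normcE.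
by case: (x i 0) (y i 0) => [a b] [c d] /=; ring.
Qed.

Lemma enorm_normalize x : x != 0 -> enorm ((enorm x)^-1%:C *: x) = 1.
Proof.
move=> x0; rewrite enormZ normc_real ?invr_ge0 ?enorm_ge0 //.
by rewrite mulVf // enorm_eq0.
Qed.

(** After normalizing both vectors, [2ab <= a^2 + b^2] applied to each coordinate sums to the bound
    1. *)
Lemma cauchy_schwarz x y : normc ((adj y *m x) 0 0) <= enorm y * enorm x.
Proof.
have unit_case (u v : 'cV[C]_n) : enorm u = 1 -> enorm v = 1 -> normc ((adj v *m u) 0 0) <= 1.
  move=> u1 v1; rewrite mxE (le_trans (ler_normc_sum _ _ _)) //.
  have -> : 1 = \sum_(i < n) (normc (v i 0) ^+ 2 + normc (u i 0) ^+ 2) / 2 :> R.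
    by rewrite -mulr_suml big_split /= -!sqr_enormE u1 v1; lra.
  apply: ler_sum => i _; rewrite !mxE normcM.
  have -> : normc (v i 0)^* = normc (v i 0).
    by case: (v i 0) => a b; rewrite /normc /= sqrrN.
  rewrite ler_pdivlMr // mulrC mulr_natl.
  by rewrite -subr_ge0 -addrA [X in _ + X]addrC addrA -sqrrB sqr_ge0.
have [->|x0] := eqVneq x 0; first by rewrite mulmx0 mxE normc0 enorm0 mulr0.
have [->|y0] := eqVneq y 0.
  rewrite enorm0 mul0r (_ : adj 0 = 0) ?mul0mx ?mxE ?normc0 //.
  by rewrite /adj map_mx0 trmx0.
have := unit_case _ _ (enorm_normalize x x0) (enorm_normalize y y0).
rewrite -scalemxAr mxE /adj map_mxZ linearZ /= -scalemxAl mxE oppr0 complexr0.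
rewrite !normcM !normc_real ?invr_ge0 ?enorm_ge0 // mulrA -invfM.
by rewrite mulrC ler_pdivrMr ?mul1r ?mulr_gt0 ?enorm_gt0 // [enorm x * _]mulrC.
Qed.

End Vectors.
End EuclideanNorm.

(** * Operator norm: bounds, transposition, rank one matrices *)

Section OperatorNorm.
Context {R : realType} {n : nat}.
Local Notation C := R[i].
Implicit Types (A : 'M[C]_n) (x : 'cV[C]_n).

Lemma opnorm_has_sup A :
  has_sup [set enorm (A *m x) | x in [set x : 'cV[C]_n | enorm x <= 1]].
Proof.
split; first by exists (enorm (A *m 0)), 0 => //=; rewrite enorm0.
(* On the unit ball every entry of [x] has modulus at most 1, so coordinate [i] of [A *m x] is
   bounded by the [i]-th absolute row sum. *)
exists (Num.sqrt (\sum_i (\sum_j normc (A i j)) ^+ 2)) => _ [x /= x1 <-].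
rewrite ler_wsqrtr //; apply: ler_sum => i _.
have s0 : 0 <= \sum_j normc (A i j) by rewrite sumr_ge0 // => j _; exact: normc_ge0.
rewrite ler_pXn2r ?nnegrE ?normc_ge0 // mxE (le_trans (ler_normc_sum _ _ _)) //.
apply: ler_sum => j _; rewrite normcM ler_piMr ?normc_ge0 //.
exact: le_trans (normc_le_enorm _ _) x1.
Qed.

Lemma le_opnorm A x : enorm (A *m x) <= opnorm A * enorm x.
Proof.
have [->|x0] := eqVneq x 0; first by rewrite mulmx0 enorm0 mulr0.
rewrite -ler_pdivrMr ?enorm_gt0 // mulrC.
rewrite -[_^-1]normc_real ?invr_ge0 ?enorm_ge0 // -enormZ scalemxAr.
apply: (ub_le_sup (proj2 (opnorm_has_sup A))).
by exists ((enorm x)^-1%:C *: x) => //=; rewrite enorm_normalize.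
Qed.

Lemma opnorm_le A t : 0 <= t -> (forall x, enorm (A *m x) <= t * enorm x) ->
  opnorm A <= t.
Proof.
move=> t0 At; apply: ge_sup; first exact: (proj1 (opnorm_has_sup A)).
by move=> _ [x /= x1 <-]; rewrite (le_trans (At x)) // ler_piMr.
Qed.

Lemma opnorm_ge0 A : 0 <= opnorm A.
Proof.
apply: (ub_le_sup (proj2 (opnorm_has_sup A))).
by exists 0 => /=; rewrite ?mulmx0 enorm0.
Qed.

Lemma opnormZ_le A t : 0 <= t -> opnorm (t%:C *: A) <= t * opnorm A.
Proof.
move=> t0; apply: opnorm_le => [|x]; first by rewrite mulr_ge0 ?opnorm_ge0.
by rewrite -scalemxAl enormZ normc_real // -mulrA ler_wpM2l // le_opnorm.
Qed.

Lemma opnorm_entry A i j : normc (A i j) <= opnorm A.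
Proof.
have e1 : enorm (delta_mx j 0 : 'cV[C]_n) = 1.
  apply/eqP; rewrite -(eqrXn2 (n := 2)) ?enorm_ge0 // sqr_enormE (bigD1 j) //=.
  rewrite mxE !eqxx normc1 big1 ?addr0 // => k /negPf kj.
  by rewrite mxE kj normc0 expr0n.
have := le_opnorm A (delta_mx j 0); rewrite e1 mulr1; apply: le_trans.
by rewrite -colE (le_trans _ (normc_le_enorm _ i)) // mxE.
Qed.

(** With [w = A^T y] and [x] the conjugate of [w], pairing [A x] with the conjugate of [y] gives
    [|w|^2]. Cauchy-Schwarz yields [|w|^2 <= |y| ||A|| |w|], and one factor [|w|] cancels. *)
Lemma opnorm_trmx_le A : opnorm A^T <= opnorm A.
Proof.
apply: opnorm_le => [|y]; first exact: opnorm_ge0.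
have [->|Ay0] := eqVneq (A^T *m y) 0.
  by rewrite enorm0 mulr_ge0 ?opnorm_ge0 ?enorm_ge0.
have conj_enorm m (z : 'cV[C]_m) : enorm (map_mx (@conjc R) z) = enorm z.
  congr Num.sqrt; apply: eq_bigr => i _; rewrite mxE !sqr_normcE.
  by case: (z i 0) => a b /=; rewrite sqrrN.
have conjK m p (z : 'M[C]_(m, p)) : map_mx (@conjc R) (map_mx (@conjc R) z) = z.
  by apply/matrixP => i j; rewrite !mxE conjcK.
set w := A^T *m y; set x := map_mx (@conjc R) w.
have xw : (adj (map_mx (@conjc R) y) *m (A *m x)) 0 0 = (enorm w ^+ 2)%:C.
  rewrite /adj conjK mulmxA -[A]trmxK -trmx_mul -/w.
  by rewrite -(conj_enorm _ w) -adj_mul_self /adj conjK.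
have := cauchy_schwarz (A *m x) (map_mx (@conjc R) y).
rewrite xw normc_real ?exprn_ge0 ?enorm_ge0 // conj_enorm expr2 => h.
have := le_trans h (ler_wpM2l (enorm_ge0 y) (le_opnorm A x)).
by rewrite conj_enorm mulrA ler_pM2r ?enorm_gt0 // mulrC.
Qed.

Lemma opnorm_trmx A : opnorm A^T = opnorm A.
Proof.
apply/eqP; rewrite eq_le; apply/andP; split; first exact: opnorm_trmx_le.
by have := opnorm_trmx_le A^T; rewrite trmxK.
Qed.

(** The image of [x] is [u] scaled by the inner product of [x] with [v]: Cauchy-Schwarz bounds it,
    and [x = v] attains the bound. *)
Lemma opnorm_rank1 (u v : 'cV[C]_n) : enorm u = 1 -> enorm v = 1 ->
  opnorm (u *m adj v) = 1.
Proof.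
move=> u1 v1; have uvE x : enorm (u *m adj v *m x) = normc ((adj v *m x) 0 0).
  by rewrite -mulmxA {1}[adj v *m x]mx11_scalar mul_mx_scalar enormZ u1 mulr1.
apply/eqP; rewrite eq_le; apply/andP; split.
  by apply: opnorm_le => // x; rewrite uvE mul1r -[enorm x]mul1r -v1 cauchy_schwarz.
have := le_opnorm (u *m adj v) v.
by rewrite uvE adj_mul_self v1 mulr1 expr1n normc1.
Qed.

(** [det0P] speaks of row vectors in a left kernel; the transposes convert these into fixed
    columns. *)
Lemma singular_kernel A :
  \det (1%:M - A) = 0 <-> exists2 x : 'cV[C]_n, x != 0 & A *m x = x.
Proof.
rewrite -det_tr; split => [/eqP/det0P[v v0 vA]|[x x0 Ax]].
  exists v^T; first by rewrite -(inj_eq trmx_inj) trmxK trmx0.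
  apply/eqP; rewrite eq_sym -subr_eq0 -{1}[v^T]mul1mx -mulmxBl.
  by rewrite -(inj_eq trmx_inj) trmx_mul trmxK trmx0 vA.
apply/eqP/det0P; exists x^T; first by rewrite -(inj_eq trmx_inj) trmxK trmx0.
by rewrite -trmx_mul mulmxBl mul1mx Ax subrr trmx0.
Qed.

End OperatorNorm.

(** * Limits of complex matrices along an ultrafilter *)

Section UltrafilterLimits.
Context {R : realType} {U : set_system nat} {UU : UltraFilter U}.
Local Notation C := R[i].

(** Compactness of [[-M, M]] gives a cluster point, and a cluster point of an ultrafilter is a
    limit: of [B] and its complement, one has its preimage in [U]. *)
Lemma bounded_ultralimit (a : nat -> R) (M : R) : (forall k, `|a k| <= M) ->
  exists p : R, a k @[k --> U] --> p.
Proof.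
move=> aM; have [|p [_ clp]] := @segment_compact _ (- M) M (a k @[k --> U]) _.
  by apply: (filterE (F := U)) => k /=; rewrite in_itv /= -ler_norml.
exists p => B pB; have [//|UB] := in_ultra_setVsetC (a @^-1` B) UU.
by have [x []] := clp (~` B) B UB pB.
Qed.

(** Complex convergence is read off the two real components, so that only limits in [R] occur. *)
Definition clim (z : nat -> C) (l : C) :=
  complex.Re (z k) @[k --> U] --> complex.Re l /\
  complex.Im (z k) @[k --> U] --> complex.Im l.

Lemma clim_bounded (z : nat -> C) (M : R) : (forall k, normc (z k) <= M) ->
  exists l, clim z l.
Proof.
move=> zM.
have [|p zp] := @bounded_ultralimit (fun k => complex.Re (z k)) M.
  by move=> k; apply: le_trans (Re_le_normc _) (zM k).
have [|q zq] := @bounded_ultralimit (fun k => complex.Im (z k)) M.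
  by move=> k; apply: le_trans (Im_le_normc _) (zM k).
by exists (p +i* q).
Qed.

Lemma clim_cst (c : C) : clim (fun=> c) c.
Proof. by split; exact: cvg_cst. Qed.

Lemma climD (z w : nat -> C) (l m : C) : clim z l -> clim w m ->
  clim (fun k => z k + w k) (l + m).
Proof.
have ReD (a b : C) : complex.Re (a + b) = complex.Re a + complex.Re b.
  by case: a b => ? ? [].
have ImD (a b : C) : complex.Im (a + b) = complex.Im a + complex.Im b.
  by case: a b => ? ? [].
move=> [zr zi] [wr wi]; split; rewrite ?ReD ?ImD.
  by under eq_fun do rewrite ReD; exact: cvgD.
by under eq_fun do rewrite ImD; exact: cvgD.
Qed.

Lemma climM (z w : nat -> C) (l m : C) : clim z l -> clim w m ->
  clim (fun k => z k * w k) (l * m).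
Proof.
have ReM (a b : C) : complex.Re (a * b) =
    complex.Re a * complex.Re b - complex.Im a * complex.Im b.
  by case: a b => ? ? [].
have ImM (a b : C) : complex.Im (a * b) =
    complex.Re a * complex.Im b + complex.Im a * complex.Re b.
  by case: a b => ? ? [].
move=> [zr zi] [wr wi]; split; rewrite ?ReM ?ImM.
  by under eq_fun do rewrite ReM; apply: cvgB; exact: cvgM.
by under eq_fun do rewrite ImM; apply: cvgD; exact: cvgM.
Qed.

Lemma clim_sum (I : Type) (s : seq I) (F : I -> nat -> C) (l : I -> C) :
  (forall i, clim (F i) (l i)) ->
  clim (fun k => \sum_(i <- s) F i k) (\sum_(i <- s) l i).
Proof.
move=> Fl; elim: s => [|i s IHs].
  by under eq_fun do rewrite big_nil; rewrite big_nil; exact: clim_cst.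
by under eq_fun do rewrite big_cons; rewrite big_cons; exact: climD.
Qed.

Lemma clim_unique (z : nat -> C) (l m : C) : clim z l -> clim z m -> l = m.
Proof.
case: l m => [a b] [c d] [/= zr zi] [/= zr' zi'].
by congr Complex; [apply: norm_cvg_unique zr zr'|apply: norm_cvg_unique zi zi'].
Qed.

Lemma clim_enorm n (x : nat -> 'cV[C]_n) (y : 'cV[C]_n) :
  (forall i, clim (fun k => x k i 0) (y i 0)) ->
  enorm (x k) ^+ 2 @[k --> U] --> enorm y ^+ 2.
Proof.
move=> xy; under eq_fun do rewrite sqr_enormE; rewrite sqr_enormE.
apply: cvg_big => [|i _]; first exact: add_continuous; have [xr xi] := xy i.
under eq_fun do rewrite sqr_normcE; rewrite sqr_normcE.
by rewrite !expr2; apply: cvgD; under eq_fun do rewrite expr2; exact: cvgM.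
Qed.

Definition mxlim m n (X : nat -> 'M[C]_(m, n)) (Y : 'M[C]_(m, n)) :=
  forall i j, clim (fun k => X k i j) (Y i j).

Lemma mxlim_cst m n (Y : 'M[C]_(m, n)) : mxlim _ _ (fun=> Y) Y.
Proof. by move=> i j; exact: clim_cst. Qed.

Lemma mxlimM m n p (X : nat -> 'M[C]_(m, n)) (Y : nat -> 'M[C]_(n, p)) A B :
  mxlim _ _ X A -> mxlim _ _ Y B -> mxlim _ _ (fun k => X k *m Y k) (A *m B).
Proof.
move=> XA YB i j; under eq_fun do rewrite mxE; rewrite mxE.
by apply: clim_sum => t; exact: climM.
Qed.

(** A subspace is closed: the entries of the projection onto [E] are fixed linear combinations of
    the entries of its argument, so projecting commutes with limits and [Y] equals its own
    projection. *)
Lemma mxlim_vspace m n (E : {vspace 'M[C]_(m, n)}) X Y :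
  (forall k, X k \in E) -> mxlim _ _ X Y -> Y \in E.
Proof.
move=> XE XY; suff -> : Y = projv E Y by exact: memv_proj.
have projE (Z : 'M[C]_(m, n)) a b : projv E Z a b =
    \sum_i \sum_j Z i j * projv E (delta_mx i j) a b.
  rewrite {1}[Z]matrix_sum_delta linear_sum summxE; apply: eq_bigr => i _.
  rewrite linear_sum summxE; apply: eq_bigr => j _.
  by rewrite linearZ mxE.
apply/matrixP => a b; apply: (clim_unique _ _ _ (XY a b)).
under eq_fun do rewrite -(projv_id (XE _)) projE; rewrite projE.
apply: clim_sum => i; apply: clim_sum => j.
by apply: climM; [exact: XY|exact: clim_cst].
Qed.

End UltrafilterLimits.

(** * Compactness: a minimal norm is attained on an affine slice of the subspace *)

Section AttainedNorm.
Context {R : realType} {n : nat}.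
Local Notation C := R[i].

(** Take approximate solutions with error [1/(k+1)]. One ultrafilter makes all their entries
    converge at once, and membership, the linear equation and the norm bound pass to the limit. *)
Lemma opnorm_le1_attained (E : {vspace 'M[C]_n}) (u v : 'cV[C]_n) :
  (forall e : R, 0 < e ->
     exists X, [/\ X \in E, (adj v *m (X *m u)) 0 0 = 1 & opnorm X <= 1 + e]) ->
  exists X, [/\ X \in E, (adj v *m (X *m u)) 0 0 = 1 & opnorm X <= 1].
Proof.
move=> EX; have {EX} /choice[X XP] (k : nat) : exists X,
    [/\ X \in E, (adj v *m (X *m u)) 0 0 = 1 & opnorm X <= 1 + harmonic k :> R].
  exact/EX/harmonic_gt0.
have [U [UU oU]] := ultraFilterLemma eventually_filter.
have /choice[f fP] (ij : 'I_n * 'I_n) :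
    exists l, clim (U := U) (fun k => X k ij.1 ij.2) l.
  (* Entries are bounded by the operator norm, which is at most [1 + 1/(k+1) <= 2]. *)
  apply: (clim_bounded _ 2) => k.
  have [_ _ Xk] := XP k; apply: le_trans (opnorm_entry _ _ _) (le_trans Xk _).
  by rewrite -[2]/(1 + 1) lerD2l /= invf_le1 ?ltr0n // ler1n.
pose Y := \matrix_(i, j) f (i, j).
have XY : mxlim (U := U) _ _ X Y by move=> i j; rewrite mxE; exact: (fP (i, j)).
exists Y; split; first by apply: (mxlim_vspace _ _ _ X) => // k; have [] := XP k.
  apply: (@clim_unique _ U _ (fun=> 1)); last exact: clim_cst.
  under eq_fun => k do have [_ <- _] := XP k.
  apply: mxlimM; first exact: mxlim_cst.
  by apply: mxlimM; [exact: XY|exact: mxlim_cst].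
apply: opnorm_le => // x.
rewrite mul1r -(ler_pXn2r (n := 2)) ?nnegrE ?enorm_ge0 //.
have lhs : enorm (X k *m x) ^+ 2 @[k --> U] --> enorm (Y *m x) ^+ 2.
  by apply: clim_enorm => i; apply: mxlimM => //; exact: mxlim_cst.
have rhs : ((1 + harmonic k) * enorm x) ^+ 2 @[k --> U] --> enorm x ^+ 2.
  have h0 : (1 + harmonic k) * enorm x @[k --> U] --> enorm x.
    rewrite -{2}[enorm x]mul1r -{2}[1]addr0; apply: cvgMl; apply: cvgD.
      exact: cvg_cst.
    (* [U] refines the eventual filter, so ordinary limits are also limits along [U]. *)
    exact: cvg_trans (cvg_app _ oU) cvg_harmonic.
  by rewrite expr2; under eq_fun do rewrite expr2; exact: cvgM.
apply: (ler_cvg_to lhs rhs); apply: nearW => k.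
rewrite ler_pXn2r ?nnegrE ?enorm_ge0 ?mulr_ge0 ?addr_ge0 ?harmonic_ge0 ?enorm_ge0 //.
have [_ _ Xk] := XP k; apply: le_trans (le_opnorm _ _) _.
by rewrite ler_wpM2r ?enorm_ge0.
Qed.

End AttainedNorm.

(** * Two-by-two determinants, and pairs with given sum and product *)

Lemma det_mx22 (S : comNzRingType) (A : 'M[S]_2) : \det A = A 0 0 * A 1 1 - A 0 1 * A 1 0.
Proof.
rewrite (expand_det_row _ 0) !big_ord_recl big_ord0 /cofactor !det_mx11 !mxE /=.
have -> : lift 0 0 = 1 :> 'I_2 by apply/val_inj.
have -> : lift 1 0 = 0 :> 'I_2 by apply/val_inj.
by rewrite expr0 expr1 mul1r mulN1r addr0 mulrN.
Qed.

(** [a] is a root of [(T - c)(T - d)], the polynomial whose coefficients are the common sum and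
    product. *)
Lemma sum_prod_eq (S : idomainType) (a b c d : S) : a + b = c + d -> a * b = c * d ->
  (a = c /\ b = d) \/ (a = d /\ b = c).
Proof.
move=> esum eprod; have eb : b = c + d - a by rewrite -esum addrAC subrr add0r.
have /eqP : (a - c) * (a - d) = 0.
  by rewrite -(subrr (c * d)) -{2}eprod eb; ring.
rewrite mulf_eq0 !subr_eq0 => /orP[] /eqP ac; [left|right];
  by rewrite eb ac; split; last ring.
Qed.

(** * Structured singular value and the three implications *)

Section StructuredSingularValue.
Context {R : realType} {E : {vspace 'M[R[i]]_2}}.
Local Notation C := R[i].
Implicit Types A X : 'M[C]_2.

(** A nonzero vector [x] fixed by [A X] satisfies [|x| <= ||A|| ||X|| |x|]. *)
Lemma singularizing_opnorm A X : singularizing E A X -> 1 <= opnorm A * opnorm X.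
Proof.
case=> _ /singular_kernel[x x0 AXx].
rewrite -(ler_pM2r (x := enorm x)) ?enorm_gt0 // mul1r -{1}AXx -mulmxA -mulrA.
by rewrite (le_trans (le_opnorm _ _)) // ler_wpM2l ?opnorm_ge0 // le_opnorm.
Qed.

(** Trades the infimum and its inverse for a pointwise inequality. In the empty case [mu] is 0 and
    the condition is vacuous; otherwise the infimum is at least [1/||A|| > 0], so inversion reverses
    order. *)
Lemma mu_leP A (s : R) : 0 <= s ->
  mu E A <= s <-> forall X, singularizing E A X -> 1 <= s * opnorm X.
Proof.
move=> s0; rewrite /mu; case: asboolP => [[X0 AX0]|Aempty]; last first.
  by split=> // _ X AX; case: Aempty; exists X.
set S := [set opnorm X | X in singularizing E A].
have A0 : 0 < opnorm A.
  rewrite lt_neqAle opnorm_ge0 andbT eq_sym; apply/eqP => A0.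
  by have := singularizing_opnorm _ _ AX0; rewrite A0 mul0r ler10.
have Sne : S !=set0 by exists (opnorm X0), X0.
have invA_le : (opnorm A)^-1 <= inf S.
  apply: lb_le_inf => // _ [X AX <-].
  by rewrite -[_^-1]mulr1 ler_pdivrMl // singularizing_opnorm.
have S0 : 0 < inf S by rewrite (lt_le_trans _ invA_le) // invr_gt0.
have infS X : singularizing E A X -> inf S <= opnorm X.
  by move=> AX; apply: ge_inf; [exists 0 => _ [Y _ <-]; exact: opnorm_ge0|exists X].
split=> [Ss X AX|sX].
  rewrite -(mulVf (lt0r_neq0 S0)) ler_pM ?invr_ge0 ?(ltW S0) ?infS //.
have s_gt0 : 0 < s.
  rewrite lt_neqAle s0 andbT eq_sym; apply/eqP => s00.
  by have := sX _ AX0; rewrite s00 mul0r ler10.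
rewrite -[s]invrK lef_pV2 ?posrE ?invr_gt0 //; apply: lb_le_inf => // _ [X AX <-].
by rewrite -[_^-1]mulr1 ler_pdivrMl // sX.
Qed.

Lemma mu_ge0 A : 0 <= mu E A.
Proof.
rewrite /mu; case: asboolP => // -[X AX]; rewrite invr_ge0.
apply: lb_le_inf; first by exists (opnorm X), X.
by move=> _ [Y _ <-]; exact: opnorm_ge0.
Qed.

Lemma mu_le_opnorm A : mu E A <= opnorm A.
Proof. by apply/mu_leP => [|X]; [exact: opnorm_ge0|exact: singularizing_opnorm]. Qed.

(** The scalar moves across the product: if [X] is singularizing for [t A], then [t X] is so for
    [A]. *)
Lemma muZ_le A t : 0 <= t -> mu E (t%:C *: A) <= t * mu E A.
Proof.
move=> t0; apply/mu_leP => [|X [XE tAX]]; first by rewrite mulr_ge0 ?mu_ge0.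
have AtX : singularizing E A (t%:C *: X).
  by split; [exact: memvZ|rewrite -scalemxAr scalemxAl].
have := (proj1 (mu_leP A _ (mu_ge0 A))) (lexx _) _ AtX.
move=> /le_trans; apply; rewrite [t * _]mulrC -mulrA ler_wpM2l ?mu_ge0 //.
exact: opnormZ_le.
Qed.

(** A nonzero fixed vector of [u v^* X] is a multiple of [u], and cancelling the scalar leaves
    [v^* X u = 1]. Conversely, that equation makes [u] nonzero and fixed. *)
Lemma singularizing_rank1 (u v : 'cV[C]_2) X :
  singularizing E (u *m adj v) X <-> X \in E /\ (adj v *m (X *m u)) 0 0 = 1.
Proof.
split=> -[XE vXu]; split=> //.
  have /singular_kernel[w w0 uvXw] := vXu.
  set c := (adj v *m (X *m w)) 0 0.
  have wE : w = c *: u.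
    by rewrite -{1}uvXw -!mulmxA [adj v *m _]mx11_scalar mul_mx_scalar.
  have c0 : c != 0 by apply: contraNneq w0 => c0; rewrite wE c0 scale0r.
  apply: (mulfI c0); rewrite mulr1 {2}/c wE.
  by rewrite -!scalemxAr [RHS]mxE.
apply/singular_kernel; exists u.
  by apply: contra_eq_neq vXu => ->; rewrite !mulmx0 mxE eq_sym oner_neq0.
by rewrite -!mulmxA [adj v *m _]mx11_scalar vXu mul_mx_scalar scale1r.
Qed.

(* Since a12 a21 = a11 a22 - det A, the coordinates determine both the sum and
   the product of the off-diagonal entries. *)
Lemma coordinates_eq A B : coordinates A = coordinates B -> A = B \/ A = B^T.
Proof.
case=> e00 e11 edet esum; rewrite !det_mx22 e00 e11 in edet.
have I2 (i : 'I_2) : i = 0 \/ i = 1.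
  by case: i => -[|[|//]] ilt; [left|right]; apply/val_inj.
have /(sum_prod_eq _ _ _ _ _ esum)[] : A 0 1 * A 1 0 = B 0 1 * B 1 0.
    by move: edet => /addrI/oppr_inj.
  case=> e01 e10; left.
  by apply/matrixP => i j; case: (I2 i) => ->; case: (I2 j) => ->.
case=> e01 e10; right.
by apply/matrixP => i j; rewrite mxE; case: (I2 i) => ->; case: (I2 j) => ->.
Qed.

Lemma domainF_eq_mu : domainF R = domainF_mu E ->
  forall A, mu E A = opnorm A.
Proof.
move=> FE A; apply/eqP; rewrite eq_le mu_le_opnorm /= leNgt; apply/negP => mult.
set t := opnorm A in mult; have t0 : 0 < t by exact: le_lt_trans (mu_ge0 A) mult.
have tV0 : 0 <= t^-1 by rewrite invr_ge0 ltW.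
(* Rescaling by [1/||A||] gives [mu E B < 1]. Equality of the domains then forces [||B|| < 1], since
   [B] is known up to transposition, whence [||A|| <= t ||B|| < t = ||A||]. *)
pose B := t^-1%:C *: A.
have : domainF R (coordinates B).
  rewrite FE; exists B => //=; apply: le_lt_trans (muZ_le _ _ tV0) _.
  by rewrite ltr_pdivrMl ?mulr1.
case=> B' /= B'1 /coordinates_eq BB'.
have {BB' B'1 B'} B1 : opnorm B < 1.
  by case: BB' B'1 => ->; [|rewrite opnorm_trmx].
have tB : t%:C *: B = A by rewrite scalerA -rmorphM mulfV ?gt_eqF // scale1r.
have := opnormZ_le B t (ltW t0); rewrite tB -/t.
by rewrite leNgt gtr_pMr // B1.
Qed.

Lemma mu_eq_transitive : (forall A, mu E A = opnorm A) ->
  forall u v : 'cV[C]_2, enorm u = 1 -> enorm v = 1 ->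
    exists A, [/\ A \in E, opnorm A = 1 & A *m u = v].
Proof.
move=> muE u v u1 v1.
have [e e0|X [XE vXu X1]] := opnorm_le1_attained E u v.
  have mu1 := muE (u *m adj v); rewrite (opnorm_rank1 _ _ u1 v1) in mu1.
  have e1 : 0 < 1 + e by rewrite addr_gt0.
  (* If every admissible [X] had norm above [1 + e], then [mu] of the rank one matrix would be at
     most [1/(1 + e) < 1], yet it equals 1. *)
  apply: contrapT => noX; suff : mu E (u *m adj v) <= (1 + e)^-1.
    by rewrite mu1 leNgt invf_lt1 ?ltrDl ?e0.
  apply/mu_leP => [|X /singularizing_rank1[XE vXu]]; first by rewrite invr_ge0 ltW.
  rewrite mulrC ler_pdivlMr // mul1r leNgt; apply/negP => Xe.
  by apply: noX; exists X; split=> //; exact: ltW.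
have Xu1 : enorm (X *m u) <= 1.
  by rewrite (le_trans (le_opnorm _ _)) // u1 mulr1.
have Xuv : X *m u = v.
  (* Expanding the square, [|X u - v|^2 = |X u|^2 + 1 - 2 <= 0]. *)
  apply/eqP; rewrite -subr_eq0 -enorm_eq0 -sqrf_eq0 eq_le sqr_ge0 andbT.
  have : enorm (X *m u) ^+ 2 <= 1 by rewrite expr_le1 ?enorm_ge0.
  by rewrite sqr_enormB vXu v1 expr1n /=; lra.
exists X; split=> //; apply/eqP; rewrite eq_le X1 /=.
by rewrite -v1 -Xuv (le_trans (le_opnorm _ _)) // u1 mulr1.
Qed.

Lemma transitive_mu_eq :
  (forall u v : 'cV[C]_2, enorm u = 1 -> enorm v = 1 ->
    exists A, [/\ A \in E, opnorm A = 1 & A *m u = v]) ->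
  forall A, mu E A = opnorm A.
Proof.
move=> trE A; apply/eqP; rewrite eq_le mu_le_opnorm /=.
apply: opnorm_le => [|x]; first exact: mu_ge0.
have [Ax0|Ax0] := eqVneq (A *m x) 0.
  by rewrite Ax0 enorm0 mulr_ge0 ?mu_ge0 ?enorm_ge0.
have x0 : x != 0 by apply: contraNneq Ax0 => ->; rewrite mulmx0.
have [B [BE B1 BAx]] := trE _ _ (enorm_normalize _ Ax0) (enorm_normalize _ x0).
set a := enorm (A *m x) in BAx *; set b := enorm x in BAx *.
have a0 : 0 < a by rewrite enorm_gt0.
have b0 : 0 < b by rewrite enorm_gt0.
(* [B] sends [A x / a] to [x / b], so [(b / a) B] sends [A x] back to [x], and [A x] is fixed by the
   product. The norm of this matrix is at most [b / a], giving [1 <= mu E A * (b / a)]. *)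
have AX : singularizing E A ((b / a)%:C *: B).
  split; first exact: memvZ.
  apply/singular_kernel; exists (A *m x) => //.
  rewrite -mulmxA -scalemxAl rmorphM /= -scalerA scalemxAr BAx scalerA.
  by rewrite -rmorphM mulfV ?gt_eqF // scale1r.
have := (proj1 (mu_leP A _ (mu_ge0 A))) (lexx _) _ AX.
have ba0 : 0 <= b / a by rewrite divr_ge0 ?ltW.
move=> h; have := le_trans h (ler_wpM2l (mu_ge0 A) (opnormZ_le B _ ba0)).
by rewrite B1 mulr1 mulrA ler_pdivlMr // mul1r.
Qed.

End StructuredSingularValue.

(** * The cycle of implications *)

Theorem theorem4p1 (R : realType) (E : {vspace 'M[R[i]]_2}) :
  [<-> domainF R = domainF_mu E;
       forall A : 'M[R[i]]_2, mu E A = opnorm A;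
       forall u v : 'cV[R[i]]_2, enorm u = 1 -> enorm v = 1 ->
         exists A : 'M[R[i]]_2, [/\ A \in E, opnorm A = 1 & A *m u = v]].
Proof.
(* The third condition returns to the first through [mu E A = opnorm A], which makes both domains
   images of the same set of matrices. *)
tfae; [exact: domainF_eq_mu|exact: mu_eq_transitive|move=> /transitive_mu_eq muE].
apply/seteqP; split=> _ [A /= A1 <-]; exists A => //=; first by rewrite muE.
by rewrite -muE.
Qed.
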